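(* Fix a strictly increasing function $T:[0,\infty)\to[0,1)$ with $T(0)=0$, and for discrete random variables $X,Y$ with finite supports of cardinality at least $2$ let $\mathrm D(X,Y)=\mathrm R(X,Y)+(1-\mathrm R(X,Y))\,\mathrm Q(X,Y)$ be the measure of dependence defined in the context. Then: (A) $\mathrm D(X,Y)$ is defined for any pair of (finitely supported discrete) random variables $X$ and $Y$, neither of them being constant with probability 1; (B) $\mathrm D(X,Y)=\mathrm D(Y,X)$; (C) $0\le \mathrm D(X,Y)\le 1$; (D) $\mathrm D(X,Y)=0$ if and only if $X$ and $Y$ are independent; (E) $\mathrm D(X,Y)=1$ if there is a strict dependence between $X$ and $Y$, i.e., either $X=f(Y)$ or $Y=g(X)$ (almost surely), where $f$ and $g$ are Borel-measurable functions; (F) if the Borel-measurable functions $f$ and $g$ map the real axis in a one-to-one way onto itself, then $\mathrm D(f(X),g(Y))=\mathrm D(X,Y)$.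
   Context: Let $X,Y$ be real discrete random variables on a common probability space with finite supports $S_X,S_Y$ (sets of values taken with positive probability) of cardinalities $R$ and $S$, $2\le R,S<\infty$. Enumerate the values so that $S_X$ and $S_Y$ are identified with $\{0,\dots,R-1\}$ and $\{0,\dots,S-1\}$, and let $p_{xy}=\mathbb P(X=x,Y=y)$ and $S_{XY}=\{(x,y):p_{xy}>0\}\subseteq S_X\times S_Y$. Let $\Gamma^\circ_{S_{XY}}$ be the linear space of real $R\times S$ matrices all of whose rows and columns sum to $0$ and whose entries vanish outside $S_{XY}$, and $d_\circ=\dim(\Gamma^\circ_{S_{XY}})$. Regional dependence: $$\mathrm R(X,Y)=\frac{(R-1)(S-1)-d_\circ}{(R-1)(S-1)}.$$ Deviation from quasi-independence: let $\Lambda$ be the $R\times S$ matrix with entries $\Lambda_{xy}=\log p_{xy}$ if $(x,y)\in S_{XY}$ and $\Lambda_{xy}=0$ otherwise. If $d_\circ>0$, let $\{E_1,\dots,E_{d_\circ}\}$ be any basis of $\Gamma^\circ_{S_{XY}}$ that is orthonormal for the Frobenius inner product $A\cdot B=\sum_{x,y}A_{xy}B_{xy}$, let $\boldsymbol\Delta_{XY}=(\Lambda\cdot E_1,\dots,\Lambda\cdot E_{d_\circ})$ (its Euclidean norm $\|\boldsymbol\Delta_{XY}\|_2$ is the Frobenius norm of the orthogonal projection of $\Lambda$ onto $\Gamma^\circ_{S_{XY}}$, hence does not depend on the orthonormal basis), and set $\mathrm Q(X,Y)=T(\|\boldsymbol\Delta_{XY}\|_2)$. If $d_\circ=0$, then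 $\mathrm R(X,Y)=1$ and $\mathrm D(X,Y)=1$ (the value of $\mathrm Q$ is irrelevant). *)

(* Defs.v *)
(* MathComp / MathComp-Analysis *)
From HB Require Import structures.
From mathcomp Require Import all_boot all_order all_algebra.
From mathcomp Require Import finmap.
From mathcomp Require Import all_classical all_reals all_analysis.

Set Implicit Arguments.
Unset Strict Implicit.
Unset Printing Implicit Defensive.

Import Order.TTheory GRing.Theory Num.Theory.
Import numFieldNormedType.Exports.

Local Open Scope classical_set_scope.
Local Open Scope ring_scope.

Section Balanced.
Context (R : realType) (m n : nat) (S : {set 'I_m * 'I_n}).

Definition balance_defect (A : 'M[R]_(m, n)) : 'cV[R]_m * 'rV[R]_n * 'M[R]_(m, n) :=
  (\col_i \sum_j A i j, \row_j \sum_i A i j,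
   \matrix_(i, j) (if (i, j) \in S then 0 else A i j)).

Fact balance_defect_is_linear : linear balance_defect.
Proof.
move=> a A B; congr (_, _, _); apply/matrixP => i j; rewrite !mxE.
- by rewrite mulr_sumr -big_split; apply: eq_bigr => k _; rewrite !mxE.
- by rewrite mulr_sumr -big_split; apply: eq_bigr => k _; rewrite !mxE.
- by case: ifP => _; rewrite ?mulr0 ?addr0.
Qed.

HB.instance Definition _ :=
  GRing.isLinear.Build R _ _ _ balance_defect balance_defect_is_linear.

Definition balanced : {vspace 'M[R]_(m, n)} := lker (linfun balance_defect).

Lemma mem_balanced (A : 'M[R]_(m, n)) :
  A \in balanced <->
  [/\ forall i, \sum_j A i j = 0, forall j, \sum_i A i j = 0
    & forall i j, (i, j) \notin S -> A i j = 0].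
Proof.
rewrite memv_ker lfunE /=; split.
  move=> /eqP[rA cA sA]; split=> [i|j|i j ijS].
  - by move/colP: rA => /(_ i); rewrite !mxE.
  - by move/rowP: cA => /(_ j); rewrite !mxE.
  - by move/matrixP: sA => /(_ i j); rewrite !mxE (negbTE ijS).
move=> [rA cA sA]; apply/eqP; congr (_, _, _); apply/matrixP => i j;
  rewrite !mxE ?rA ?cA //.
by case: ifPn => // /sA.
Qed.

End Balanced.

Arguments balanced R {m n} S.

Definition frobenius (R : realType) (m n : nat) (A B : 'M[R]_(m, n)) : R :=
  \sum_i \sum_j A i j * B i j.

Definition orthonormal_basis (R : realType) (m n : nat) (U : {vspace 'M[R]_(m, n)})
    (E : (\dim U).-tuple 'M[R]_(m, n)) : Prop :=
  basis_of U E /\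
  forall k l : 'I_(\dim U), frobenius (tnth E k) (tnth E l) = (k == l)%:R.

(* The norm `|v| that the library puts on row vectors is the sup norm. *)
Definition euclidean_norm (R : realType) (k : nat) (v : 'rV[R]_k) : R :=
  Num.sqrt (\sum_i v ord0 i ^+ 2).

Section Table.
Context (R : realType) (m n : nat) (p : 'M[R]_(m, n)).

Definition table_support : {set 'I_m * 'I_n} := [set ij | 0 < p ij.1 ij.2]%SET.

Definition table_space : {vspace 'M[R]_(m, n)} := balanced R table_support.

Definition regional_dependence : R :=
  ((m%:R - 1) * (n%:R - 1) - (\dim table_space)%:R) / ((m%:R - 1) * (n%:R - 1)).

Definition log_table : 'M[R]_(m, n) :=
  \matrix_(i, j) (if (i, j) \in table_support then ln (p i j) else 0).

Definition deviation (E : (\dim table_space).-tuple 'M[R]_(m, n)) :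
    'rV[R]_(\dim table_space) :=
  \row_k frobenius log_table (tnth E k).

Definition quasi_independence_deviation (T : R -> R)
    (E : (\dim table_space).-tuple 'M[R]_(m, n)) : R :=
  T (euclidean_norm (deviation E)).

(* If table_space is trivial then regional_dependence = 1, and the second
   summand vanishes whatever the value of T. *)
Definition table_dependence (T : R -> R)
    (E : (\dim table_space).-tuple 'M[R]_(m, n)) : R :=
  regional_dependence +
  (1 - regional_dependence) * quasi_independence_deviation T E.

End Table.

Section Dependence.
Context (d : measure_display) (Omega : measurableType d) (R : realType).
Context (P : probability Omega R).
Implicit Types X Y : Omega -> R.

Definition rv_support X : set R := [set x | (0 < P (X @^-1` [set x]))%E].

(* The second condition is what makes X discrete: a continuous variable has
   an empty support. *)
Definition finitely_supported X : Prop :=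
  finite_set (rv_support X) /\ P (X @^-1` rv_support X) = 1%E.

Definition almost_surely_constant X : Prop :=
  exists c : R, {ae P, forall w, X w = c}.

Definition independent X Y : Prop :=
  forall A B : set R, measurable A -> measurable B ->
    P (X @^-1` A `&` Y @^-1` B) = (P (X @^-1` A) * P (Y @^-1` B))%E.

Definition joint_table X Y (m n : nat) (ex : 'I_m -> R) (ey : 'I_n -> R) :
    'M[R]_(m, n) :=
  \matrix_(i, j) fine (P [set w | X w = ex i /\ Y w = ey j]).

(* D is the value obtained from some enumeration of the two supports and some
   orthonormal basis; that this choice does not matter is part of what
   "D(X, Y) is defined" asserts. *)
Definition is_dependence (T : R -> R) X Y (D : R) : Prop :=
  exists (m n : nat) (ex : 'I_m -> R) (ey : 'I_n -> R)
         (E : (\dim (table_space (joint_table X Y ex ey))).-tuple 'M[R]_(m, n)),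
    [/\ set_bij setT (rv_support X) ex, set_bij setT (rv_support Y) ey,
        orthonormal_basis E & D = table_dependence T E].

Definition dependence (T : R -> R) X Y : R := xget 0 (is_dependence T X Y).

End Dependence.

(* Main.v *)
Require Import Defs.
From HB Require Import structures.
From mathcomp Require Import all_boot all_order all_algebra.
From mathcomp Require Import finmap.
From mathcomp Require Import all_classical all_reals all_analysis.
From mathcomp Require Import ring.

Set Implicit Arguments.
Unset Strict Implicit.
Unset Printing Implicit Defensive.

Import Order.TTheory GRing.Theory Num.Theory.
Import numFieldNormedType.Exports.

Local Open Scope classical_set_scope.
Local Open Scope ring_scope.

(** Write D for the measure of dependence, computed from an m x n table p of joint
probabilities.  Two different facts are needed: D does not depend on the choices
made in its definition, and its extreme values can be read off from p.

Independence of the choices.  The norm of the deviation vector is the Frobenius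
norm of the orthogonal projection V of the table of logarithms onto the balanced
space ([orthonormal_projection]), and V is characterised without reference to a
basis: it is the element of that space that has the same inner products with
its elements as the table of logarithms.  Hence D is preserved by any linear
isometry that carries one balanced space and one table of logarithms to the other
ones and leaves (m-1)(n-1) unchanged ([table_dependence_isometry]).  Relabelling
the values of X and Y and transposing the table are such isometries; the first
gives uniqueness, the second symmetry.  One-to-one transformations of X and Y do
not even change the table, only the labels of its rows and columns.  Existence is
Gram-Schmidt.

Values.  Deleting the first row and column is injective on balanced matrices, so
the dimension of their space is at most (m-1)(n-1); this and 0 <= T < 1 bound D.  Equality of
dimensions holds only for full support: at a cell outside the support, a
2 x 2 tetrad with entries +1, -1, -1, +1 is balanced but does not vanish there
([dim_balanced_eq]).  So D = 0 forces full support, and, T being strictly increasing,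
V = 0: the logarithms are orthogonal to every tetrad, that is
p_ij p_kl = p_il p_kj ([table_dependence_eq0]).  Summation over k and l turns these
identities into p_ij = p_i p_j, which is independence, because the
atoms carry all the mass ([independent_cross_ratio]).  If X is almost surely a function of
Y, each column of the table has at most one positive entry; zero column sums then
leave only the zero balanced matrix, and D = 1. *)

(** * The Frobenius inner product and orthogonal projections *)

Section Frobenius.
Context (R : realType) (m n : nat).
Implicit Types A B : 'M[R]_(m, n).

Lemma frobeniusC A B : frobenius A B = frobenius B A.
Proof.
by apply: eq_bigr => i _; apply: eq_bigr => j _; rewrite mulrC.
Qed.

Fact frobenius_linear A : linear_for *%R (frobenius A).
Proof.
move=> a B C; rewrite /frobenius mulr_sumr -big_split.
apply: eq_bigr => i _; rewrite mulr_sumr -big_split.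
by apply: eq_bigr => j _; rewrite !mxE mulrDr mulrCA.
Qed.

HB.instance Definition _ A :=
  GRing.isLinear.Build R 'M[R]_(m, n) R *%R (frobenius A) (frobenius_linear A).

Lemma frobenius_ge0 A : 0 <= frobenius A A.
Proof. by do 2!apply: sumr_ge0 => ? _; rewrite -expr2 sqr_ge0. Qed.

Lemma frobenius_eq0 A : frobenius A A = 0 -> A = 0.
Proof.
move/eqP; rewrite psumr_eq0 => [|i _]; last first.
  by apply: sumr_ge0 => j _; rewrite -expr2 sqr_ge0.
move/allP => A0; apply/matrixP => i j; rewrite mxE.
have /= := A0 i (mem_index_enum i); rewrite psumr_eq0 => [|k _]; last first.
  by rewrite -expr2 sqr_ge0.
by move=> /allP/(_ j (mem_index_enum j)) /=; rewrite mulf_eq0 orbb => /eqP.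
Qed.

Definition orthonormal k (E : k.-tuple 'M[R]_(m, n)) : Prop :=
  forall i j : 'I_k, frobenius (tnth E i) (tnth E j) = (i == j)%:R.

Lemma frobenius_orthonormal_sum k (E : k.-tuple 'M[R]_(m, n)) (c : 'I_k -> R) i :
  orthonormal E -> frobenius (tnth E i) (\sum_j c j *: tnth E j) = c i.
Proof.
move=> oE; rewrite linear_sum (bigD1 i) //= linearZ /= oE eqxx mulr1.
rewrite big1 ?addr0 // => j ji; rewrite linearZ /= oE eq_sym (negbTE ji).
by rewrite mulr0.
Qed.

Lemma orthonormal_free k (E : k.-tuple 'M[R]_(m, n)) : orthonormal E -> free E.
Proof.
move=> oE; apply/freeP => c cE i.
rewrite -(frobenius_orthonormal_sum c i oE).
under eq_bigr do rewrite (tnth_nth 0).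
by rewrite cE linear0.
Qed.

(** The Gram-Schmidt step: as long as the family is shorter than [\dim U], some
vector of U lies outside its span, and its component orthogonal to the family is
nonzero. *)
Lemma exists_orthonormal (U : {vspace 'M[R]_(m, n)}) k : (k <= \dim U)%N ->
  exists2 E : k.-tuple 'M[R]_(m, n), orthonormal E & {subset E <= U}.
Proof.
elim: k => [_|k IHk ltkU]; first by exists [tuple] => // -[].
have [E oE EU] := IHk (ltnW ltkU).
have /subvPn[B BU BE] : ~~ (U <= <<E>>)%VS.
  apply: contraL ltkU => /dimvS; rewrite -leqNgt => /leq_trans -> //.
  by rewrite (leq_trans (dim_span E)) // size_tuple.
pose C := B - \sum_i frobenius B (tnth E i) *: tnth E i.
have CU : C \in U.
  rewrite rpredB // rpred_sum // => i _; rewrite rpredZ //.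
  by apply: EU; rewrite mem_tnth.
have EC i : frobenius (tnth E i) C = 0.
  by rewrite linearB /= frobenius_orthonormal_sum // frobeniusC subrr.
have C0 : 0 < frobenius C C.
  rewrite lt_def frobenius_ge0 andbT; apply: contraNneq BE => /frobenius_eq0.
  move/eqP; rewrite subr_eq0 => /eqP ->; rewrite rpred_sum // => i _.
  by rewrite rpredZ // memv_span // mem_tnth.
pose e := (Num.sqrt (frobenius C C))^-1 *: C.
have Ee i : frobenius (tnth E i) e = 0 by rewrite linearZ /= EC mulr0.
exists [tuple of e :: E] => [i j|A]; last first.
  by rewrite inE => /predU1P[->|/EU//]; rewrite rpredZ.
case: (unliftP ord0 i) => [i'|] ->; case: (unliftP ord0 j) => [j'|] ->;
  rewrite ?tnthS ?tnth0.
- by rewrite oE (inj_eq lift_inj).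
- by rewrite Ee.
- by rewrite frobeniusC Ee.
rewrite {1}/e frobeniusC linearZ /= [frobenius e C]frobeniusC linearZ /= mulrA.
rewrite -invfM -expr2 sqr_sqrtr ?ltW //.
by rewrite ?eqxx mulVf // gt_eqF.
Qed.

Lemma exists_orthonormal_basis (U : {vspace 'M[R]_(m, n)}) :
  exists E : (\dim U).-tuple 'M[R]_(m, n), orthonormal_basis E.
Proof.
have [E oE EU] := exists_orthonormal (leqnn (\dim U)).
exists E; split=> //; rewrite basisEfree orthonormal_free // size_tuple leqnn.
by rewrite andbT; apply/span_subvP.
Qed.

(** V is the orthogonal projection of L onto U.  The inner products with the
elements of U determine it, which is why its norm cannot depend on E. *)
Lemma orthonormal_projection (U : {vspace 'M[R]_(m, n)})
    (E : (\dim U).-tuple 'M[R]_(m, n)) L : orthonormal_basis E ->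
  exists2 V, V \in U & (forall A, A \in U -> frobenius L A = frobenius V A) /\
    \sum_k frobenius L (tnth E k) ^+ 2 = frobenius V V.
Proof.
move=> [bE oE]; pose V := \sum_k frobenius L (tnth E k) *: tnth E k.
have EU k : tnth E k \in U by rewrite (basis_mem bE) // mem_tnth.
have VU : V \in U by rewrite rpred_sum // => k _; rewrite rpredZ.
have LV A : A \in U -> frobenius L A = frobenius V A.
  move=> AU; rewrite (coord_basis bE AU) !linear_sum; apply: eq_bigr => k _.
  rewrite !linearZ /= -tnth_nth [frobenius V _]frobeniusC.
  by rewrite frobenius_orthonormal_sum.
exists V => //; split=> //; rewrite -LV // linear_sum.
by apply: eq_bigr => k _; rewrite linearZ.
Qed.

End Frobenius.

Lemma euclidean_norm_deviation (R : realType) (m n : nat) (p : 'M[R]_(m, n))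
    (E : (\dim (table_space p)).-tuple 'M[R]_(m, n)) : orthonormal_basis E ->
  exists2 V, V \in table_space p &
    (forall A, A \in table_space p ->
       frobenius (log_table p) A = frobenius V A) /\
    euclidean_norm (deviation E) = Num.sqrt (frobenius V V).
Proof.
move=> /(orthonormal_projection (log_table p))[V VU [LV EV]].
exists V => //; split=> //; rewrite /euclidean_norm -EV; congr Num.sqrt.
by apply: eq_bigr => k _; rewrite mxE.
Qed.

Lemma dimv_le_inj (K : fieldType) (vT wT : vectType K) (f : {linear vT -> wT})
    (U : {vspace vT}) (W : {vspace wT}) :
  (forall v, v \in U -> f v \in W) -> (forall v, v \in U -> f v = 0 -> v = 0) ->
  (\dim U <= \dim W)%N.
Proof.
move=> fUW finj; rewrite -(limg_dim_eq (f := linfun f)).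
  by apply/dimvS/subvP => _ /memv_imgP[v vU ->]; rewrite lfunE; apply: fUW.
apply/eqP; rewrite -subv0; apply/subvP => v.
rewrite memv_cap memv_ker lfunE memv0 => /andP[vU /eqP fv0].
exact/eqP/finj.
Qed.

(** * Invariance of the measure of dependence under isometries *)

Section Invariance.
Context (R : realType) (T : R -> R) (m n m' n' : nat).
Context (p : 'M[R]_(m, n)) (q : 'M[R]_(m', n')).
Context (phi : {linear 'M[R]_(m, n) -> 'M[R]_(m', n')}).
Context (psi : {linear 'M[R]_(m', n') -> 'M[R]_(m, n)}).

(** The image under phi of the projection of the first table of logarithms has the
property that characterises the projection of the second one, so both have the
same norm. *)
Lemma table_dependence_isometry
    (E : (\dim (table_space p)).-tuple 'M[R]_(m, n))
    (F : (\dim (table_space q)).-tuple 'M[R]_(m', n')) :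
  cancel phi psi -> cancel psi phi ->
  (forall A B, frobenius (phi A) B = frobenius A (psi B)) ->
  (forall A, A \in table_space p -> phi A \in table_space q) ->
  (forall B, B \in table_space q -> psi B \in table_space p) ->
  phi (log_table p) = log_table q ->
  (m%:R - 1) * (n%:R - 1) = (m'%:R - 1) * (n'%:R - 1) :> R ->
  orthonormal_basis E -> orthonormal_basis F ->
  table_dependence T E = table_dependence T F.
Proof.
move=> phiK psiK adj phiU psiU phiL size_eq oE oF.
have dim_eq : \dim (table_space p) = \dim (table_space q).
  apply/eqP; rewrite eqn_leq (dimv_le_inj (f := phi)) ?(dimv_le_inj (f := psi)) //.
    by move=> B _ psiB0; rewrite -(psiK B) psiB0 linear0.
  by move=> A _ phiA0; rewrite -(phiK A) phiA0 linear0.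
have [V VU [LV normV]] := euclidean_norm_deviation oE.
have [W WU [LW normW]] := euclidean_norm_deviation oF.
have WV : W = phi V.
  apply/eqP; rewrite -subr_eq0; apply/eqP/frobenius_eq0.
  have DU : W - phi V \in table_space q by rewrite rpredB // phiU.
  rewrite linearB /= [frobenius _ W]frobeniusC [frobenius _ (phi V)]frobeniusC.
  rewrite -LW // adj.
  by rewrite -LV ?psiU // -phiL adj subrr.
rewrite /table_dependence /quasi_independence_deviation normV normW WV adj phiK.
by rewrite /regional_dependence size_eq dim_eq.
Qed.

End Invariance.

(** * The dimension of the space of balanced matrices *)

Section BalancedDimension.
Context (R : realType).

(** The sums determine a balanced matrix from its entries outside the first row and
column: first the remaining entries of the first row, then the first column. *)
Lemma dim_balanced_le (m n : nat) (S : {set 'I_m * 'I_n}) :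
  (\dim (balanced R S) <= m.-1 * n.-1)%N.
Proof.
have := dimvS (subvf (balanced R S)); rewrite dimvf dim_matrix.
case: m n S => [|m] [|n] S; rewrite ?mul0r ?mulr0 ?mul0n ?muln0 // => _ /=.
rewrite -[(m * n)%N](dim_matrix R m n) -dimvf.
pose f : {linear 'M[R]_(m.+1, n.+1) -> 'M[R]_(m, n)} :=
  mxsub (lift ord0) (lift ord0).
apply: (dimv_le_inj (f := f)) => [A _|A /mem_balanced[rA cA _] fA0].
  exact: memvf.
have Aj i j : A i (lift ord0 j) = 0.
  have A'0 k : A (lift ord0 k) (lift ord0 j) = 0.
    by move/matrixP: fA0 => /(_ k j); rewrite !mxE.
  have := cA (lift ord0 j); rewrite big_ord_recl (eq_bigr (fun=> 0)) //.
  rewrite big1 // addr0 => A00.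
  by case: (unliftP ord0 i) => [k|] ->.
apply/matrixP => i j; rewrite mxE; case: (unliftP ord0 j) => [k|] ->; first exact: Aj.
have := rA i; rewrite big_ord_recl big1 ?addr0 // => k _; exact: Aj.
Qed.

(** The matrix L has zero row sums, so B |-> L^T B L produces balanced matrices;
L contains an identity block, so this map is injective. *)
Lemma dim_balanced_setT (m n : nat) : (0 < m)%N -> (0 < n)%N ->
  \dim (balanced R [set: 'I_m * 'I_n]%SET) = (m.-1 * n.-1)%N.
Proof.
case: m n => [//|m] [//|n] _ _; apply/eqP; rewrite eqn_leq dim_balanced_le /=.
rewrite -[(m * n)%N](dim_matrix R m n) -dimvf.
pose L k : 'M[R]_(k, 1 + k) := row_mx (const_mx (- 1) : 'cV_k) 1%:M.
pose P k : 'M[R]_(k, 1 + k) := row_mx (0 : 'cV_k) 1%:M.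
have LP k : L k *m (P k)^T = 1%:M.
  by rewrite /P tr_row_mx mul_row_col !trmx0 trmx1 mulmx0 mulmx1 add0r.
have L1 k : L k *m const_mx 1 = 0 :> 'cV_k.
  rewrite -(col_mx_const 1 k 1) mul_row_col mul1mx; apply/matrixP => i j.
  by rewrite !mxE big_ord1 !mxE mulr1 addNr.
pose f : {linear 'M[R]_(m, n) -> 'M[R]_(m.+1, n.+1)} :=
  mulmx (L m)^T \o mulmxr (L n).
apply: (dimv_le_inj (f := f)) => [B _|B _ fB0].
  apply/mem_balanced; split=> [i|j|i j]; last by rewrite inE.
    have /matrixP/(_ i ord0) : f B *m const_mx 1 = 0 :> 'cV_m.+1.
      by rewrite /= -!mulmxA L1 !mulmx0.
    rewrite !mxE => fBi; rewrite -{}[RHS]fBi; apply: eq_bigr => j _.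
    by rewrite [const_mx _ _ _]mxE mulr1.
  have /matrixP/(_ ord0 j) : (const_mx 1)^T *m f B = 0 :> 'rV_n.+1.
    by rewrite /= mulmxA -trmx_mul L1 trmx0 mul0mx.
  rewrite !mxE => fBj; rewrite -{}[RHS]fBj; apply: eq_bigr => i _.
  by rewrite !mxE mul1r.
have : P m *m f B *m (P n)^T = B.
  rewrite /= !mulmxA -[P m *m _]trmxK trmx_mul trmxK LP trmx1 mul1mx -mulmxA LP.
  by rewrite mulmx1.
by rewrite fB0 mulmx0 mul0mx.
Qed.

(** The simplest balanced matrices, the moves of the theory of contingency tables.
Orthogonality to them expresses the additivity of a table. *)
Definition tetrad (m n : nat) (i k : 'I_m) (j l : 'I_n) : 'M[R]_(m, n) :=
  delta_mx i j - delta_mx i l - delta_mx k j + delta_mx k l.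

Lemma frobenius_delta (m n : nat) (A : 'M[R]_(m, n)) i j :
  frobenius A (delta_mx i j) = A i j.
Proof.
rewrite /frobenius (bigD1 i) //= (bigD1 j) //= !mxE !eqxx mulr1.
rewrite [X in _ + X + _]big1 => [|l /negbTE lj]; last by rewrite mxE lj andbF mulr0.
rewrite big1 ?addr0 // => k /negbTE ki.
by rewrite big1 // => l _; rewrite mxE ki mulr0.
Qed.

Lemma frobenius_tetrad (m n : nat) (A : 'M[R]_(m, n)) i k j l :
  frobenius A (tetrad i k j l) = A i j - A i l - A k j + A k l.
Proof. by rewrite linearD !linearB /= !frobenius_delta. Qed.

Lemma tetrad_balanced (m n : nat) (i k : 'I_m) (j l : 'I_n) :
  tetrad i k j l \in balanced R [set: 'I_m * 'I_n]%SET.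
Proof.
have sum_eq q (a : 'I_q) : \sum_b ((b == a)%:R : R) = 1.
  by rewrite (bigD1 a) //= eqxx big1 ?addr0 // => b /negbTE ->.
apply/mem_balanced; split=> [a|b|a b]; last by rewrite inE.
  under eq_bigr do rewrite !mxE -!mulnb !natrM.
  by rewrite big_split !sumrB /= -!mulr_sumr !sum_eq !mulr1; ring.
under eq_bigr do rewrite !mxE -!mulnb !natrM.
by rewrite big_split !sumrB /= -!mulr_suml !sum_eq !mul1r; ring.
Qed.

(** If S omits the cell (i, j), a tetrad with corner (i, j) is balanced for the full
support but not for S, so the dimension drops. *)
Lemma dim_balanced_eq (m n : nat) (S : {set 'I_m * 'I_n}) :
  (1 < m)%N -> (1 < n)%N ->
  (\dim (balanced R S) == m.-1 * n.-1)%N = (S == [set: 'I_m * 'I_n]%SET).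
Proof.
move=> m1 n1; have [m0 n0] := (ltnW m1, ltnW n1).
apply/eqP/eqP => [dimS|->]; last exact: dim_balanced_setT.
have balS : balanced R S = balanced R [set: 'I_m * 'I_n]%SET.
  apply/eqP; rewrite eqEdim dim_balanced_setT // dimS leqnn andbT.
  apply/subvP => A /mem_balanced[rA cA _]; apply/mem_balanced.
  by split=> // i j; rewrite inE.
apply/eqP; rewrite -finset.subTset; apply/fintype.subsetP => -[i j] _.
have other q (a : 'I_q) : (1 < q)%N -> exists b : 'I_q, b != a.
  case: q a => [[]//|[[]//|q]] a _.
  case: (eqVneq a ord0) => [->|a0]; last by exists ord0; rewrite eq_sym.
  by exists (lift ord0 ord0).
have [[k ki] [l lj]] := (other _ i m1, other _ j n1).
apply: contraT => ijS.
have := tetrad_balanced i k j l; rewrite -balS => /mem_balanced[_ _ /(_ i j ijS)].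
rewrite !mxE !eqxx ![i == _]eq_sym ![j == _]eq_sym (negbTE ki) (negbTE lj) /=.
by rewrite !subr0 addr0 => /eqP; rewrite oner_eq0.
Qed.

End BalancedDimension.

(** * The measure of dependence of a table *)

Section TableDependence.
Context (R : realType) (T : R -> R) (m n : nat) (p : 'M[R]_(m, n)).
Hypotheses (m1 : (1 < m)%N) (n1 : (1 < n)%N).
Context (T_range : forall t : R, 0 <= t -> 0 <= T t < 1).
Context (E : (\dim (table_space p)).-tuple 'M[R]_(m, n)).

Lemma regional_dependenceE :
  regional_dependence p = 1 - (\dim (table_space p))%:R / (m.-1 * n.-1)%:R.
Proof.
have predE q : (1 < q)%N -> q%:R - 1 = q.-1%:R :> R.
  by case: q => // q _; rewrite -natr1 addrK.
rewrite /regional_dependence !predE // -natrM mulrBl divff //.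
by rewrite pnatr_eq0 -lt0n muln_gt0 -!subn1 !subn_gt0 m1.
Qed.

Lemma regional_dependence_itv : 0 <= regional_dependence p <= 1.
Proof.
have mn0 : 0 < (m.-1 * n.-1)%:R :> R.
  by rewrite ltr0n muln_gt0 -!subn1 !subn_gt0 m1.
rewrite regional_dependenceE subr_ge0 ler_pdivrMr // mul1r ler_nat.
by rewrite dim_balanced_le gerBl divr_ge0.
Qed.

Lemma regional_dependence_eq0 :
  (regional_dependence p == 0) = (table_support p == [set: 'I_m * 'I_n]%SET).
Proof.
have mn0 : (m.-1 * n.-1)%:R != 0 :> R.
  by rewrite pnatr_eq0 -lt0n muln_gt0 -!subn1 !subn_gt0 m1.
rewrite regional_dependenceE subr_eq0 eq_sym -(inj_eq (mulIf mn0)) mul1r.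
by rewrite divfK // eqr_nat dim_balanced_eq.
Qed.

Lemma quasi_independence_deviation_itv :
  0 <= quasi_independence_deviation T E < 1.
Proof. exact/T_range/sqrtr_ge0. Qed.

Lemma table_dependence_itv : 0 <= table_dependence T E <= 1.
Proof.
have /andP[r0 r1] := regional_dependence_itv.
have /andP[q0 /ltW q1] := quasi_independence_deviation_itv.
apply/andP; split; first by rewrite addr_ge0 // mulr_ge0 // subr_ge0.
by rewrite -lerBrDl ler_piMr // subr_ge0.
Qed.

Lemma table_dependence_eq1 : (forall A, A \in table_space p -> A = 0) ->
  table_dependence T E = 1.
Proof.
move=> U0; have dim0 : \dim (table_space p) = 0%N.
  apply/eqP; rewrite dimv_eq0 -subv0; apply/subvP => A /U0 ->.
  by rewrite memv0.
by rewrite /table_dependence regional_dependenceE dim0 mul0r subr0 subrr mul0r addr0.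
Qed.

(** For a positive table the cross-ratio identities say that ln p_ij is the sum of a
function of i and a function of j, and such sums are exactly the matrices orthogonal to all
matrices with zero row and column sums. *)
Lemma table_dependence_eq0 (T_incr : forall s t : R, 0 <= s -> s < t -> T s < T t)
    (T_0 : T 0 = 0) : orthonormal_basis E ->
  table_dependence T E = 0 <->
  (forall i j, 0 < p i j) /\ forall i k j l, p i j * p k l = p i l * p k j.
Proof.
move=> oE; have [V VU [LV normV]] := euclidean_norm_deviation oE.
have /andP[r0 r1] := regional_dependence_itv.
have /andP[q0 _] := quasi_independence_deviation_itv.
have logE : (forall i j, 0 < p i j) -> forall i j, log_table p i j = ln (p i j).
  by move=> p0 i j; rewrite mxE inE /= p0.
split=> [/eqP|[p0 pE]].
  rewrite /table_dependence paddr_eq0 //; last by rewrite mulr_ge0 // subr_ge0.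
  move=> /andP[r_eq0].
  rewrite (eqP r_eq0) subr0 mul1r => /eqP TE.
  move: r_eq0; rewrite regional_dependence_eq0 => /eqP Sfull.
  have p0 i j : 0 < p i j.
    have : (i, j) \in table_support p by rewrite Sfull inE.
    by rewrite inE.
  split=> // i k j l.
  have norm0 : euclidean_norm (deviation E) = 0.
    apply/eqP; rewrite eq_le sqrtr_ge0 andbT leNgt; apply/negP.
    by move=> /(T_incr _ _ (lexx 0)); rewrite T_0 [T _]TE ltxx.
  have V0 : V = 0.
    apply/frobenius_eq0/eqP; rewrite eq_le frobenius_ge0 andbT.
    by rewrite -sqrtr_eq0 -normV norm0.
  have : tetrad R i k j l \in table_space p.
    by rewrite /table_space Sfull tetrad_balanced.
  move/LV; rewrite V0 [frobenius 0 _]frobeniusC linear0 frobenius_tetrad !logE // => lnE.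
  apply: ln_inj; rewrite ?posrE ?mulr_gt0 // !lnM ?posrE //.
  by apply/eqP; rewrite -subr_eq0 -lnE; apply/eqP; ring.
have LA A : A \in table_space p -> frobenius (log_table p) A = 0.
  move=> /mem_balanced[rA cA _].
  have [i0 j0] : 'I_m * 'I_n by split; exists 0%N; [exact: ltnW m1 | exact: ltnW n1].
  (* The additive decomposition comes from the cross-ratio identity at the corner (i0, j0). *)
  have lnE i j : log_table p i j = ln (p i j0) + (ln (p i0 j) - ln (p i0 j0)).
    rewrite logE // addrA; apply/eqP; rewrite eq_sym subr_eq -!lnM ?posrE //.
    by rewrite pE.
  rewrite /frobenius.
  under eq_bigr do under eq_bigr do rewrite lnE mulrDl.
  under eq_bigr do rewrite big_split /= -mulr_sumr rA mulr0 add0r.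
  by rewrite exchange_big big1 // => j _; rewrite -mulr_sumr cA mulr0.
rewrite /table_dependence /quasi_independence_deviation normV -LV // LA // sqrtr0.
rewrite T_0 mulr0 addr0; apply/eqP; rewrite regional_dependence_eq0 -finset.subTset.
by apply/fintype.subsetP => -[i j] _; rewrite inE p0.
Qed.

End TableDependence.

(** * Relabelling and transposition of tables *)

Section Relabelling.
Context (R : realType).

Lemma table_space_mxsub (m n m' n' : nat) (p : 'M[R]_(m, n))
    (s : 'I_m' -> 'I_m) (t : 'I_n' -> 'I_n) A :
  bijective s -> bijective t -> A \in table_space p ->
  mxsub s t A \in table_space (mxsub s t p).
Proof.
move=> bs bt /mem_balanced[rA cA sA]; apply/mem_balanced; split=> [i|j|i j].
- rewrite -[RHS](rA (s i)) (reindex t) /=; last exact: onW_bij.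
  by apply: eq_bigr => j _; rewrite mxE.
- rewrite -[RHS](cA (t j)) (reindex s) /=; last exact: onW_bij.
  by apply: eq_bigr => i _; rewrite mxE.
- by rewrite inE /= !mxE => pij; apply: sA; rewrite inE.
Qed.

Lemma table_dependence_mxsub (T : R -> R) (m n m' n' : nat) (p : 'M[R]_(m, n))
    (s : 'I_m' -> 'I_m) (t : 'I_n' -> 'I_n)
    (E : (\dim (table_space p)).-tuple 'M[R]_(m, n))
    (F : (\dim (table_space (mxsub s t p))).-tuple 'M[R]_(m', n')) :
  bijective s -> bijective t -> orthonormal_basis E -> orthonormal_basis F ->
  table_dependence T E = table_dependence T F.
Proof.
move=> bs bt; have [[s' sK s'K] [t' tK t'K]] := (bs, bt).
have [mE nE] : m' = m /\ n' = n.
  by split; rewrite -[LHS]card_ord -[RHS]card_ord;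
    [apply: bij_eq_card bs | apply: bij_eq_card bt].
pose phi : {linear 'M[R]_(m, n) -> 'M[R]_(m', n')} := mxsub s t.
pose psi : {linear 'M[R]_(m', n') -> 'M[R]_(m, n)} := mxsub s' t'.
have phiK : cancel phi psi.
  by move=> A; apply/matrixP => i j; rewrite !mxE s'K t'K.
have psiK : cancel psi phi.
  by move=> A; apply/matrixP => i j; rewrite !mxE sK tK.
move=> oE oF; apply: (table_dependence_isometry T phiK psiK _ _ _ _ _ oE oF).
- move=> A B; rewrite [RHS](reindex s) /=; last exact: onW_bij.
  apply: eq_bigr => i _; rewrite [RHS](reindex t) /=; last exact: onW_bij.
  by apply: eq_bigr => j _; rewrite !mxE sK tK.
- by move=> A; apply: table_space_mxsub.
- move=> A AU; rewrite -[p]phiK.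
  by apply: table_space_mxsub AU; [exists s | exists t].
- by apply/matrixP => i j; rewrite !mxE !inE /= !mxE.
- by rewrite mE nE.
Qed.

Lemma table_space_tr (m n : nat) (p : 'M[R]_(m, n)) A :
  A \in table_space p -> A^T \in table_space p^T.
Proof.
move=> /mem_balanced[rA cA sA]; apply/mem_balanced; split=> [i|j|i j].
- by rewrite -[RHS](cA i); apply: eq_bigr => j _; rewrite mxE.
- by rewrite -[RHS](rA j); apply: eq_bigr => i _; rewrite mxE.
- by rewrite inE /= !mxE => pij; apply: sA; rewrite inE.
Qed.

Lemma table_dependence_tr (T : R -> R) (m n : nat) (p : 'M[R]_(m, n))
    (E : (\dim (table_space p)).-tuple 'M[R]_(m, n))
    (F : (\dim (table_space p^T)).-tuple 'M[R]_(n, m)) :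
  orthonormal_basis E -> orthonormal_basis F ->
  table_dependence T E = table_dependence T F.
Proof.
pose phi : {linear 'M[R]_(m, n) -> 'M[R]_(n, m)} := trmx.
pose psi : {linear 'M[R]_(n, m) -> 'M[R]_(m, n)} := trmx.
have phiK : cancel phi psi by move=> A; apply: trmxK.
have psiK : cancel psi phi by move=> A; apply: trmxK.
move=> oE oF; apply: (table_dependence_isometry T phiK psiK _ _ _ _ _ oE oF).
- move=> A B; rewrite /frobenius exchange_big; apply: eq_bigr => i _.
  by apply: eq_bigr => j _; rewrite !mxE.
- exact: table_space_tr.
- by move=> B /table_space_tr; rewrite trmxK.
- by apply/matrixP => i j; rewrite !mxE !inE /= !mxE.
- by rewrite mulrC.
Qed.

Lemma exists_enumeration (A : set R) : finite_set A ->
  exists e : 'I_(#|` fset_set A|) -> R, set_bij setT A e.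
Proof.
move=> finA; exists (fun i => nth 0 (fset_set A) i); split=> [i _|i j _ _|x Ax] /=.
- by apply/set_mem; rewrite -in_fset_set // mem_nth.
- by move/eqP; rewrite nth_uniq ?fset_uniq // => /eqP/val_inj.
- have xA : x \in fset_set A by rewrite in_fset_set // inE.
  have ltx : (index x (fset_set A) < #|` fset_set A|)%N by rewrite index_mem.
  by exists (Ordinal ltx) => //=; rewrite nth_index.
Qed.

Lemma enumeration_bij (A : set R) (m m' : nat) (e : 'I_m -> R) (e' : 'I_m' -> R) :
  set_bij setT A e -> set_bij setT A e' ->
  exists2 s : 'I_m' -> 'I_m, bijective s & e' = e \o s.
Proof.
have factor k k' (u : 'I_k -> R) (u' : 'I_k' -> R) :
    set_bij setT A u -> set_bij setT A u' -> {s : 'I_k' -> 'I_k & forall i, u' i = u (s i)}.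
  move=> [_ _ usurj] [u'A _ _]; apply: (@choice _ _ (fun i j => u' i = u j)) => i.
  by have [j _ <-] := usurj _ (u'A i I); exists j.
move=> be be'; have [s es] := factor _ _ _ _ be be'.
have [s' es'] := factor _ _ _ _ be' be.
exists s; last exact/funext.
exists s' => i; [have [_ inj _] := be' | have [_ inj _] := be].
  by apply: inj; rewrite ?inE // -es' -es.
by apply: inj; rewrite ?inE // -es -es'.
Qed.

End Relabelling.

(** * Well-definedness and invariance of the dependence of two random variables *)

Section DependenceWellDefined.
Context (d : measure_display) (Omega : measurableType d) (R : realType).
Context (P : probability Omega R) (T : R -> R).
Implicit Types X Y : Omega -> R.

(** Two enumerations of the same support differ by a bijection of indices, so the
two joint tables differ by a permutation of rows and columns. *)
Lemma is_dependence_unique X Y D D' :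
  is_dependence P T X Y D -> is_dependence P T X Y D' -> D = D'.
Proof.
move=> [m [n [ex [ey [E [bx by_ oE ->]]]]]].
move=> [m' [n' [ex' [ey' [E' [bx' by' oE' ->]]]]]].
have [s bs exE] := enumeration_bij bx bx'.
have [t bt eyE] := enumeration_bij by_ by'.
have pE : joint_table P X Y ex' ey' = mxsub s t (joint_table P X Y ex ey).
  by apply/matrixP => i j; rewrite !mxE exE eyE.
by move: E' oE'; rewrite pE => E' oE'; apply: table_dependence_mxsub.
Qed.

Lemma exists_is_dependence X Y :
  finite_set (rv_support P X) -> finite_set (rv_support P Y) ->
  exists (ex : 'I_(#|` fset_set (rv_support P X)|) -> R)
         (ey : 'I_(#|` fset_set (rv_support P Y)|) -> R)
         (E : (\dim (table_space (joint_table P X Y ex ey))).-tuple _),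
    [/\ set_bij setT (rv_support P X) ex, set_bij setT (rv_support P Y) ey,
        orthonormal_basis E & is_dependence P T X Y (table_dependence T E)].
Proof.
move=> /exists_enumeration[ex bx] /exists_enumeration[ey by_].
have [E oE] := exists_orthonormal_basis (table_space (joint_table P X Y ex ey)).
by exists ex, ey, E; split=> //; exists _, _, ex, ey, E.
Qed.

Lemma dependenceE X Y D : is_dependence P T X Y D -> dependence P T X Y = D.
Proof.
by move=> XYD; apply: xget_unique => // D'; move/is_dependence_unique; apply.
Qed.

Lemma is_dependence_sym X Y D : is_dependence P T X Y D -> is_dependence P T Y X D.
Proof.
move=> [m [n [ex [ey [E [bx by_ oE ->]]]]]]; exists n, m, ey, ex.
have -> : joint_table P Y X ey ex = (joint_table P X Y ex ey)^T.
  apply/matrixP => i j; rewrite !mxE; congr (fine (P _)).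
  by apply/seteqP; split=> w [].
have [F oF] := exists_orthonormal_basis (table_space (joint_table P X Y ex ey)^T).
by exists F; split=> //; apply: table_dependence_tr.
Qed.

Lemma rv_support_comp X (f : R -> R) : bijective f ->
  rv_support P (f \o X) = f @` rv_support P X.
Proof.
move=> [g fK gK].
have pre x : (f \o X) @^-1` [set f x] = X @^-1` [set x].
  by apply/seteqP; split=> w /= => [/(can_inj fK)|->].
apply/seteqP; split=> [y|_ [x + <-]]; rewrite /rv_support /= ?pre //.
by rewrite -[y]gK pre => Py; exists (g y).
Qed.

Lemma is_dependence_comp X Y (f g : R -> R) D : bijective f -> bijective g ->
  is_dependence P T X Y D -> is_dependence P T (f \o X) (g \o Y) D.
Proof.
move=> bf bg [m [n [ex [ey [E [bx by_ oE ->]]]]]].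
exists m, n, (f \o ex), (g \o ey).
have [finj ginj] := (bij_inj bf, bij_inj bg).
have -> : joint_table P (f \o X) (g \o Y) (f \o ex) (g \o ey) = joint_table P X Y ex ey.
  apply/matrixP => i j; rewrite !mxE; congr (fine (P _)).
  by apply/seteqP; split=> w [/= XE YE]; split;
    [exact: finj|exact: ginj|rewrite XE|rewrite YE].
have comp_bij k (A : set R) (e : 'I_k -> R) (h : R -> R) :
    injective h -> set_bij setT A e -> set_bij setT (h @` A) (h \o e).
  move=> hinj [eA einj esurj]; split=> [i _|i j iT jT /hinj|_ [x Ax <-]].
  - by exists (e i) => //; apply: eA.
  - exact: einj.
  - by have [i _ <-] := esurj _ Ax; exists i.
by exists E; rewrite !rv_support_comp //; split=> //; apply: comp_bij.
Qed.

End DependenceWellDefined.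

(** * From the joint table to the joint distribution *)

Section Probability.
Context (d : measure_display) (Omega : measurableType d) (R : realType).
Context (P : probability Omega R).

Lemma fine_probabilityK (A : set Omega) : measurable A -> (fine (P A))%:E = P A.
Proof. by move=> mA; rewrite fineK // fin_num_measure. Qed.

Lemma measurable_fiber (X : {RV P >-> R}) (x : R) : measurable (X @^-1` [set x]).
Proof. exact: measurable_funPTI. Qed.

(** The fibers of X over its support are disjoint and together have probability 1. *)
Lemma total_probability (X : {RV P >-> R}) (m : nat) (ex : 'I_m -> R)
    (F : set Omega) : finitely_supported P X ->
  set_bij setT (rv_support P X) ex -> measurable F ->
  fine (P F) = \sum_i fine (P (F `&` X @^-1` [set ex i])).
Proof.
move=> [_ PG1] [exA exI exS] mF.
pose H i := X @^-1` [set ex i].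
have mH i : measurable (H i) by exact: measurable_fiber.
have GE : X @^-1` rv_support P X = \big[setU/set0]_i H i.
  rewrite -bigcup_seq; apply/seteqP; split=> w /=.
    by move=> /exS[i _ exi]; exists i => //=; rewrite mem_index_enum.
  by move=> [i _ ->]; apply: exA.
have mG : measurable (X @^-1` rv_support P X) by rewrite GE; apply: bigsetU_measurable.
have PGC : P (~` (X @^-1` rv_support P X)) = 0%E.
  by rewrite probability_setC // PG1 subee.
have null : P (F `\` X @^-1` rv_support P X) = 0%E.
  apply: (subset_measure0 _ _ _ PGC); first exact: measurableD.
    exact: measurableC.
  by move=> w [].
have -> : P F = P (F `&` X @^-1` rv_support P X).
  have PF : P F = (P (_ `\` _) + P (_ `&` _))%E := measureDI P mF mG.
  by rewrite PF null add0e.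
rewrite GE big_distrr /=.
rewrite measure_semi_additive_ord.
- by rewrite sum_fine // => i _; rewrite fin_num_measure //; apply: measurableI.
- by move=> i; apply: measurableI.
- move=> i j _ _ [w [[_ Xi] [_ Xj]]]; apply: exI; rewrite ?inE //.
  by rewrite -Xi -Xj.
- by apply: bigsetU_measurable => i _; apply: measurableI.
Qed.

Lemma fine_probability_ind (X : {RV P >-> R}) (m : nat) (ex : 'I_m -> R)
    (F : set Omega) (A : set R) : finitely_supported P X ->
  set_bij setT (rv_support P X) ex -> measurable F -> measurable A ->
  fine (P (F `&` X @^-1` A)) =
  \sum_i (ex i \in A)%:R * fine (P (F `&` X @^-1` [set ex i])).
Proof.
move=> finX bx mF mA; rewrite (total_probability finX bx); last first.
  by apply: measurableI => //; apply: measurable_funPTI.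
apply: eq_bigr => i _; case: (asboolP (A (ex i))) => Ai.
  rewrite mem_set // mul1r; congr (fine (P _)).
  by apply/seteqP; split=> w /= [] => [[]|Fw ->].
rewrite memNset // mul0r (_ : _ `&` _ = set0) ?measure0 //.
by apply/seteqP; split=> w //= [[_ XA] Xi]; rewrite Xi in XA.
Qed.

Section Table.
Context (X Y : {RV P >-> R}) (m n : nat) (ex : 'I_m -> R) (ey : 'I_n -> R).
Hypotheses (finX : finitely_supported P X) (finY : finitely_supported P Y).
Hypotheses (bx : set_bij setT (rv_support P X) ex).
Hypotheses (by_ : set_bij setT (rv_support P Y) ey).
Local Notation p := (joint_table P X Y ex ey).

Lemma joint_tableE i j :
  p i j = fine (P (X @^-1` [set ex i] `&` Y @^-1` [set ey j])).
Proof. by rewrite mxE. Qed.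

Lemma joint_table_row_sum i : \sum_j p i j = fine (P (X @^-1` [set ex i])).
Proof.
rewrite (total_probability finY by_ (measurable_fiber X (ex i))).
by apply: eq_bigr => j _; rewrite joint_tableE.
Qed.

Lemma joint_table_col_sum j : \sum_i p i j = fine (P (Y @^-1` [set ey j])).
Proof.
rewrite (total_probability finX bx (measurable_fiber Y (ey j))).
by apply: eq_bigr => i _; rewrite joint_tableE setIC.
Qed.

Lemma joint_table_sum : \sum_i \sum_j p i j = 1.
Proof.
rewrite (eq_bigr _ (fun i _ => joint_table_row_sum i)).
have -> : 1 = fine (P setT) by rewrite probability_setT.
by rewrite (total_probability finX bx measurableT); apply: eq_bigr => i _; rewrite setTI.
Qed.

Lemma row_marginal_gt0 i : 0 < fine (P (X @^-1` [set ex i])).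
Proof.
have [exA _ _] := bx; have /= Pi : rv_support P X (ex i) by exact: exA.
by rewrite -lte_fin fine_probabilityK //; apply: measurable_fiber.
Qed.

Lemma col_marginal_gt0 j : 0 < fine (P (Y @^-1` [set ey j])).
Proof.
have [eyA _ _] := by_; have /= Pj : rv_support P Y (ey j) by exact: eyA.
by rewrite -lte_fin fine_probabilityK //; apply: measurable_fiber.
Qed.

Lemma independent_table : independent P X Y <->
  forall i j, p i j = fine (P (X @^-1` [set ex i])) * fine (P (Y @^-1` [set ey j])).
Proof.
split=> [indep i j|pE A B mA mB].
  rewrite joint_tableE indep ?fineM ?fin_num_measure //;
    exact: measurable_fiber || exact: measurable_set1.
have mXA := measurable_funPTI X mA; have mYB := measurable_funPTI Y mB.
rewrite -(fine_probabilityK (measurableI _ _ mXA mYB)).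
rewrite -(fine_probabilityK mXA) -(fine_probabilityK mYB) -EFinM; congr _%:E.
rewrite (fine_probability_ind finY by_) //.
have := fine_probability_ind finX bx measurableT mA; rewrite setTI => ->.
have := fine_probability_ind finY by_ measurableT mB; rewrite setTI => ->.
rewrite mulr_sumr; apply: eq_bigr => j _.
rewrite setIC (fine_probability_ind finX bx (measurable_fiber Y (ey j)) mA).
rewrite mulr_sumr mulr_suml; apply: eq_bigr => i _.
rewrite !setTI setIC -joint_tableE pE; ring.
Qed.

(** Summing p_ij p_kl = p_il p_kj over k and l gives p_ij on the left, as the table
sums to 1, and the product of the two marginals on the right. *)
Lemma independent_cross_ratio : independent P X Y <->
  (forall i j, 0 < p i j) /\ forall i k j l, p i j * p k l = p i l * p k j.
Proof.
rewrite independent_table; split=> [pE|[_ pE] i j].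
  split=> [i j|i k j l]; last by rewrite !pE; ring.
  by rewrite pE mulr_gt0 ?row_marginal_gt0 ?col_marginal_gt0.
rewrite -joint_table_row_sum -joint_table_col_sum -[LHS]mulr1 -joint_table_sum.
rewrite mulr_sumr mulr_suml [RHS](eq_bigr _ (fun l _ => mulr_sumr _ _ _ _)).
rewrite [RHS]exchange_big; apply: eq_bigr => k _.
by rewrite mulr_sumr; apply: eq_bigr => l _.
Qed.

(** The cell (i, j) is null unless x_i = f(y_j), so each column has at most one
cell in the support; the column sum forces the entry there to vanish. *)
Lemma functional_table_space (f : R -> R) :
  {ae P, forall w, X w = f (Y w)} ->
  forall A, A \in table_space p -> A = 0.
Proof.
move=> XfY A /mem_balanced[_ cA sA]; have [_ exI _] := bx.
have off i j : ex i != f (ey j) -> A i j = 0.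
  move=> /eqP ij; apply: sA; rewrite inE /= -leNgt joint_tableE.
  have mXY : measurable (X @^-1` [set ex i] `&` Y @^-1` [set ey j]).
    by apply: measurableI; apply: measurable_fiber.
  suff -> : P (X @^-1` [set ex i] `&` Y @^-1` [set ey j]) = 0%E by [].
  apply: (measure_negligible mXY).
  apply: negligibleS XfY => w [/= Xi Yj] XfYw.
  by apply: ij; rewrite -Xi -Yj.
apply/matrixP => i j; rewrite mxE; case: (eqVneq (ex i) (f (ey j))) => [eij|/off//].
rewrite -[RHS](cA j) (bigD1 i) //= big1 ?addr0 // => k ki.
apply: off; rewrite -eij; apply: contra_neq ki => exk.
by apply: exI; rewrite ?inE.
Qed.

End Table.

End Probability.

Theorem mainTheorem4 (R : realType) (T : R -> R)
    (T_range : forall t : R, 0 <= t -> 0 <= T t < 1)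
    (T_incr : forall s t : R, 0 <= s -> s < t -> T s < T t)
    (T_0 : T 0 = 0)
    (d : measure_display) (Omega : measurableType d) (P : probability Omega R)
    (X Y : {RV P >-> R})
    (finX : finitely_supported P X) (finY : finitely_supported P Y) :
  (~ almost_surely_constant P X -> ~ almost_surely_constant P Y ->
     exists! D : R, is_dependence P T X Y D) /\
  ((2 <= #|` fset_set (rv_support P X)|)%N -> (2 <= #|` fset_set (rv_support P Y)|)%N ->
   [/\ dependence P T X Y = dependence P T Y X,
       0 <= dependence P T X Y <= 1,
       dependence P T X Y = 0 <-> independent P X Y,
       (exists2 f : R -> R, measurable_fun setT f & {ae P, forall w, X w = f (Y w)}) \/
       (exists2 g : R -> R, measurable_fun setT g & {ae P, forall w, Y w = g (X w)}) ->
       dependence P T X Y = 1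
     & forall f g : R -> R,
         measurable_fun setT f -> measurable_fun setT g ->
         bijective f -> bijective g ->
         dependence P T (f \o X) (g \o Y) = dependence P T X Y]).
Proof.
have [ex [ey [E [bx by_ oE XYD]]]] := exists_is_dependence T finX.1 finY.1.
split=> [_ _|m1 n1].
  by exists (table_dependence T E); split=> // D'; apply: is_dependence_unique.
rewrite (dependenceE XYD) (dependenceE (is_dependence_sym XYD)); split=> //.
- exact: table_dependence_itv.
- rewrite (table_dependence_eq0 m1 n1 T_range T_incr T_0 oE).
  by symmetry; apply: independent_cross_ratio.
- case=> [[f _ XfY]|[g _ YgX]].
    exact/table_dependence_eq1/(functional_table_space bx XfY).
  rewrite -(dependenceE (is_dependence_sym XYD)).
  have [ey' [ex' [F [by' bx' oF YXD]]]] := exists_is_dependence T finY.1 finX.1.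
  by rewrite (dependenceE YXD); apply/table_dependence_eq1/(functional_table_space by' YgX).
- by move=> f g _ _ bf bg; apply/dependenceE/is_dependence_comp.
Qed.
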